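(* Let $H,K$ be Hilbert spaces and let $T$ be a densely defined closable operator from $D(T)\subset H$ into $K$ which has decomposable domain, $D(T)=N(T)\oplus^{\perp}C(T)$, and satisfies $N(\overline{T})=\overline{N(T)}$. Then $T\subset(T^{\dagger})^{\dagger}\subset\overline{T}$.
   Context: Operators are linear and defined on a linear subspace $D(T)$ (the domain) of a Hilbert space; $N(T)$ and $R(T)$ are the null space and range. The carrier of $T$ is $C(T)=D(T)\cap N(T)^{\perp}$. $\oplus^{\perp}$ denotes orthogonal direct sum of subspaces. $T$ has decomposable domain if $D(T)=N(T)\oplus^{\perp}C(T)$. For $T$ with decomposable domain, the Moore-Penrose (generalized) inverse is the linear operator $T^{\dagger}:D(T^{\dagger})=R(T)\oplus^{\perp}R(T)^{\perp}\subset K\to H$ determined by $T^{\dagger}y=(T|_{C(T)})^{-1}y$ for $y\in R(T)$ and $T^{\dagger}y=0$ for $y\in R(T)^{\perp}$. The assertion is understood to include that the operators to which $\dagger$ is applied have decomposable domain. $T$ is closable if it has a closed extension; $\overline{T}$ is its minimal closed extension. $A\subset B$ for operators means $D(A)\subset D(B)$ and $Bx=Ax$ for $x\in D(A)$. *)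

(* Defs.v *)
From HB Require Import structures.
From mathcomp Require Import all_boot all_order all_algebra.
From mathcomp Require Import complex.
From mathcomp Require Import all_classical all_reals all_analysis.

Set Implicit Arguments.
Unset Strict Implicit.
Unset Printing Implicit Defensive.

Import Order.TTheory GRing.Theory Num.Theory.
Import numFieldNormedType.Exports.

Local Open Scope classical_set_scope.
Local Open Scope ring_scope.

(* Hilbert spaces are real or complex; both cases are treated at once. *)
Variant scalar_kind := RealScalars | ComplexScalars.

Definition scalar (R : realType) (s : scalar_kind) : numFieldType :=
  match s with RealScalars => R | ComplexScalars => R[i]%C end.

Definition scalar_conj (R : realType) (s : scalar_kind) :
    scalar R s -> scalar R s :=
  match s return scalar R s -> scalar R s with
  | RealScalars => id
  | ComplexScalars => @conjc R
  end.

(* The inner product is linear in its first argument. *)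
Record hilbertSpace (R : realType) (s : scalar_kind) := HilbertSpace {
  hilbert_sort :> completeNormedModType (scalar R s);
  inner : {dot hilbert_sort for @scalar_conj R s};
  inner_norm : forall x : hilbert_sort, inner x x = `|x| ^+ 2
}.

Arguments inner {R s h}.

(* An operator is total as a Rocq function, but only its values on [dom] are
   meaningful: equality and inclusion of operators ignore the other ones. *)
Record operator (R : realType) (s : scalar_kind) (H K : hilbertSpace R s) :=
  Operator {
  dom : set H;
  op_fun :> H -> K;
  dom0 : dom 0;
  dom_linear : forall (a : scalar R s) x y, dom x -> dom y -> dom (a *: x + y);
  op_linear : forall (a : scalar R s) x y, dom x -> dom y ->
    op_fun (a *: x + y) = a *: op_fun x + op_fun y
}.

Section Operators.
Context {R : realType} {s : scalar_kind}.

Definition perp {H : hilbertSpace R s} (A : set H) : set H :=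
  [set x | forall a, A a -> inner x a = 0].

Definition set_sum {H : hilbertSpace R s} (A B : set H) : set H :=
  [set x | exists2 a, A a & exists2 b, B b & x = a + b].

Definition is_orth_dsum {H : hilbertSpace R s} (V A B : set H) : Prop :=
  V = set_sum A B /\ forall a b, A a -> B b -> inner a b = 0.

Context {H K : hilbertSpace R s}.
Implicit Types T S : operator H K.

Definition null_space T : set H := [set x | dom T x /\ T x = 0].

Definition op_range T : set K := [set T x | x in dom T].

Definition carrier T : set H := dom T `&` perp (null_space T).

Definition graph T : set (H * K) := [set p | dom T p.1 /\ T p.1 = p.2].

Definition op_sub T S : Prop :=
  dom T `<=` dom S /\ forall x, dom T x -> S x = T x.

Definition closed_op T : Prop := closed (graph T).

Definition closable T : Prop := exists2 S, closed_op S & op_sub T S.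

Definition is_min_closed_extension T S : Prop :=
  [/\ closed_op S, op_sub T S &
      forall S', closed_op S' -> op_sub T S' -> op_sub S S'].

Definition decomposable T : Prop :=
  is_orth_dsum (dom T) (null_space T) (carrier T).

(* The second clause says that [S y] is the preimage of [y] under the
   restriction of [T] to its carrier, on which [T] is injective. *)
Definition is_mp_inverse T (S : operator K H) : Prop :=
  [/\ is_orth_dsum (dom S) (op_range T) (perp (op_range T)),
      forall y, op_range T y -> carrier T (S y) /\ T (S y) = y &
      forall y, perp (op_range T) y -> S y = 0].

End Operators.

Lemma scalar_conj0 (R : realType) (s : scalar_kind) :
  scalar_conj (0 : scalar R s) = 0.
Proof. by case: s => //; exact: conjc0. Qed.

Section InnerTheory.
Context {R : realType} {s : scalar_kind} {H : hilbertSpace R s}.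
Implicit Types (x y : H) (A : set H).

Lemma inner_eq0 x : inner x x = 0 -> x = 0.
Proof.
by rewrite inner_norm => /eqP; rewrite expf_eq0 normr_eq0 /= => /eqP.
Qed.

Lemma innerDl (a : scalar R s) x y z :
  inner (a *: x + y) z = a * inner x z + inner y z.
Proof. by rewrite linearPl. Qed.

Lemma inner_sym0 x y : inner x y = 0 -> inner y x = 0.
Proof.
move=> xy0; rewrite hermitian_subproof expr0 mul1r /= xy0.
exact: scalar_conj0.
Qed.

Lemma perp0 A : perp A 0.
Proof. by move=> a _; rewrite linear0l. Qed.

Lemma perp_linear A (a : scalar R s) x y :
  perp A x -> perp A y -> perp A (a *: x + y).
Proof. by move=> px py z Az; rewrite innerDl px// py// mulr0 addr0. Qed.

Lemma perp_disj A x : A x -> perp A x -> x = 0.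
Proof. by move=> Ax px; apply/inner_eq0/px. Qed.

End InnerTheory.

Section OperatorTheory.
Context {R : realType} {s : scalar_kind} {H K : hilbertSpace R s}.
Implicit Types T S : operator H K.

Lemma op0 T : T 0 = 0.
Proof.
have := op_linear (-1) (dom0 T) (dom0 T).
by rewrite scaler0 addr0 scaleN1r addNr.
Qed.

Lemma op_range0 T : op_range T 0.
Proof. by exists 0; [exact: dom0|exact: op0]. Qed.

Lemma op_range_linear T (a : scalar R s) x y :
  op_range T x -> op_range T y -> op_range T (a *: x + y).
Proof.
move=> [u du <-] [v dv <-]; exists (a *: u + v); last exact: op_linear.
exact: dom_linear.
Qed.

Lemma carrier0 T : carrier T 0.
Proof. by split; [exact: dom0|exact: perp0]. Qed.

Lemma carrier_linear T (a : scalar R s) x y :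
  carrier T x -> carrier T y -> carrier T (a *: x + y).
Proof.
by move=> [dx px] [dy py]; split; [exact: dom_linear|exact: perp_linear].
Qed.

Lemma carrier_inj T x y : carrier T x -> carrier T y -> T x = T y -> x = y.
Proof.
move=> cx cy Txy; apply/eqP; rewrite eq_sym -subr_eq0; apply/eqP.
have [dxy pxy] := carrier_linear (-1) cx cy.
rewrite addrC -scaleN1r; apply: (perp_disj _ pxy); split => //.
rewrite op_linear ?Txy ?scaleN1r ?addNr//; [exact: cx.1|exact: cy.1].
Qed.

Section MinClosedExtension.
Variables (T : operator H K) (cT : closable T).

Let mce_graph (x : H) (y : K) :=
  forall S, closed_op S -> op_sub T S -> dom S x /\ S x = y.
Let mce_dom : set H := [set x | exists y, mce_graph x y].
Let mce_fun (x : H) : K := xget 0 (mce_graph x).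

Let mce_graph_uniq x y z : mce_graph x y -> mce_graph x z -> y = z.
Proof. by case: cT => S cS TS /(_ S cS TS)[_ <-] /(_ S cS TS)[_ <-]. Qed.

Let mce_funE x y : mce_graph x y -> mce_fun x = y.
Proof.
by move=> gxy; apply: (mce_graph_uniq _ gxy); apply: xgetPex; exists y.
Qed.

Let mce_graph_linear (a : scalar R s) x y u v :
  mce_graph x u -> mce_graph y v -> mce_graph (a *: x + y) (a *: u + v).
Proof.
move=> gx gy S cS TS; have [dx <-] := gx S cS TS; have [dy <-] := gy S cS TS.
by split; [exact: dom_linear|exact: op_linear].
Qed.

Let mce_dom0 : mce_dom 0.
Proof. by exists 0 => S _ _; split; [exact: dom0|exact: op0]. Qed.

Let mce_dom_linear (a : scalar R s) x y :
  mce_dom x -> mce_dom y -> mce_dom (a *: x + y).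
Proof.
by move=> [u gu] [v gv]; exists (a *: u + v); exact: mce_graph_linear.
Qed.

Let mce_op_linear (a : scalar R s) x y : mce_dom x -> mce_dom y ->
  mce_fun (a *: x + y) = a *: mce_fun x + mce_fun y.
Proof.
move=> [u gu] [v gv]; rewrite (mce_funE gu) (mce_funE gv).
exact/mce_funE/mce_graph_linear.
Qed.

Lemma min_closed_extension_exists :
  exists S : operator H K, is_min_closed_extension T S.
Proof.
exists (Operator mce_dom0 mce_dom_linear mce_op_linear); split.
- rewrite /closed_op; set G := graph _.
  have -> : G = \bigcap_(S in [set S | closed_op S /\ op_sub T S]) graph S.
    apply/seteqP; split=> [[x y] [/= [z gz] fxy] S [cS TS]|[x y] g].
      by rewrite /graph/= -fxy (mce_funE gz); exact: gz.
    have gxy : mce_graph x y by move=> S cS TS; exact: (g S (conj cS TS)).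
    by split; [exists y|exact: mce_funE].
  by apply: closed_bigI => S [].
- split=> x dx.
    by exists (T x) => S _ [dTS TS]; split; [exact: dTS|exact: TS].
  by apply: mce_funE => S _ [dTS TS]; split; [exact: dTS|exact: TS].
- move=> S cS TS; split=> x [y gxy]; first by case: (gxy S cS TS).
  by rewrite /= (mce_funE gxy); case: (gxy S cS TS).
Qed.

Definition op_closure : operator H K :=
  projT1 (cid min_closed_extension_exists).

Lemma op_closureP : is_min_closed_extension T op_closure.
Proof. exact: projT2 (cid min_closed_extension_exists). Qed.

End MinClosedExtension.

Section MPInverse.
Variables (T : operator H K) (dT : decomposable T).

Let mp_dom := set_sum (op_range T) (perp (op_range T)).
Let mp_graph (y : K) (x : H) := carrier T x /\ perp (op_range T) (y - T x).
Let mp_fun (y : K) : H := xget 0 (mp_graph y).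

Let op_range_carrier y : op_range T y -> exists2 x, carrier T x & T x = y.
Proof.
move=> [x + <-]; rewrite {1}dT.1 => -[n [dn Tn] [c cc ->]]; exists c => //.
by rewrite -[n]scale1r op_linear ?Tn ?scaler0 ?add0r//; exact: cc.1.
Qed.

Let mp_graph_uniq y x x' : mp_graph y x -> mp_graph y x' -> x = x'.
Proof.
move=> [cx px] [cx' px']; apply: (carrier_inj cx cx').
apply/eqP; rewrite -subr_eq0; apply/eqP; apply: (@perp_disj _ _ _ (op_range T)).
  rewrite addrC -scaleN1r.
  by apply: op_range_linear; [exists x' => //; exact: cx'.1
                             |exists x => //; exact: cx.1].
suff -> : T x - T x' = (-1) *: (y - T x) + (y - T x') by exact: perp_linear.
by rewrite scaleN1r opprB addrA subrK.
Qed.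

Let mp_funE y x : mp_graph y x -> mp_fun y = x.
Proof. by move=> g; apply: (mp_graph_uniq _ g); apply: xgetPex; exists x. Qed.

Let mp_dom_graph y : mp_dom y -> exists x, mp_graph y x.
Proof.
move=> [r /op_range_carrier[x cx <-] [p pp ->]]; exists x; split => //.
by rewrite addrAC subrr add0r.
Qed.

Let mp_graph_linear (a : scalar R s) y z u v :
  mp_graph y u -> mp_graph z v -> mp_graph (a *: y + z) (a *: u + v).
Proof.
move=> [cu pu] [cv pv]; split; first exact: carrier_linear.
rewrite op_linear; [|exact: cu.1|exact: cv.1].
by rewrite opprD addrACA -scalerBr; exact: perp_linear.
Qed.

Let mp_dom0 : mp_dom 0.
Proof.
by exists 0; [exact: op_range0|exists 0; [exact: perp0|rewrite addr0]].
Qed.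

Let mp_dom_linear (a : scalar R s) x y :
  mp_dom x -> mp_dom y -> mp_dom (a *: x + y).
Proof.
move=> [r rr [p pp ->]] [r' rr' [p' pp' ->]].
exists (a *: r + r'); first exact: op_range_linear.
exists (a *: p + p'); first exact: perp_linear.
by rewrite scalerDr addrACA.
Qed.

Let mp_op_linear (a : scalar R s) x y : mp_dom x -> mp_dom y ->
  mp_fun (a *: x + y) = a *: mp_fun x + mp_fun y.
Proof.
move=> /mp_dom_graph[u gu] /mp_dom_graph[v gv].
by rewrite (mp_funE gu) (mp_funE gv); exact/mp_funE/mp_graph_linear.
Qed.

Lemma mp_inverse_exists : exists S : operator K H, is_mp_inverse T S.
Proof.
exists (Operator mp_dom0 mp_dom_linear mp_op_linear); split => /=.
- by split=> // a b ra /(_ _ ra)/inner_sym0.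
- move=> y /op_range_carrier[x cx <-].
  suff -> : mp_fun (T x) = x by [].
  by apply: mp_funE; split=> //; rewrite subrr; exact: perp0.
- move=> y py; apply: mp_funE; split; first exact: carrier0.
  by rewrite op0 subr0.
Qed.

Definition mp_inverse : operator K H := projT1 (cid mp_inverse_exists).

Lemma mp_inverseP : is_mp_inverse T mp_inverse.
Proof. exact: projT2 (cid mp_inverse_exists). Qed.

End MPInverse.

End OperatorTheory.

(* Main.v *)
Require Import Defs.
From mathcomp Require Import all_boot all_order all_algebra.
From mathcomp Require Import all_classical all_reals all_analysis.

(** The inverse [T^dagger] has null space [R(T)^perp], carrier [R(T)] and range
    [C(T)], so it is decomposable, and [(T^dagger)^dagger] has domain
    [C(T) + C(T)^perp], agrees with [T] on [C(T)] and vanishes on [C(T)^perp].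
    As [N(T)] lies in [C(T)^perp], this extends [T].  Conversely, if [x] is
    orthogonal to [C(T)] and [n + c] is close to [x], with [n] in [N(T)] and
    [c] in [C(T)], then by Pythagoras [n] is at least as close to [x]; hence
    density of [D(T)] puts [C(T)^perp] inside the closure of [N(T)], which is
    the null space of the closure of [T]. *)

Import Order.TTheory GRing.Theory Num.Theory.
Import numFieldNormedType.Exports.

Local Open Scope classical_set_scope.
Local Open Scope ring_scope.

Section Orthogonality.
Context {R : realType} {s : scalar_kind} {H : hilbertSpace R s}.
Implicit Types (x y : H) (A B : set H).

Lemma ler_norm_orthD x y : inner x y = 0 -> `|x| <= `|x + y|.
Proof.
move=> xy0; rewrite -ler_sqr ?nnegrE ?normr_ge0// -!inner_norm.
rewrite linearDr /= !linearDl /= xy0 (inner_sym0 xy0) addr0 add0r lerDl.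
by rewrite inner_norm exprn_ge0.
Qed.

Lemma perp_sub_closure {A B} :
  dense (set_sum A B) -> (forall a b, A a -> B b -> inner a b = 0) ->
  perp B `<=` closure A.
Proof.
move=> dAB AB x px V /nbhs_ballP[e e0 xeV].
have xe0 : ball x e !=set0 by exists x; exact: ballxx.
have [ab [xab [a Aa [b Bb Eab]]]] := dAB _ xe0 (ball_open x e).
exists a; split=> //; apply: xeV; move: xab; rewrite -ball_normE /= Eab.
(* Split [x - (a + b)] as [(x - a) + (- b)]: both [x] and [a] are orthogonal to [b], so dropping
   [- b] cannot increase the norm. *)
apply: le_lt_trans; rewrite opprD addrA; apply: ler_norm_orthD.
by rewrite linearNr linearBl /= (AB a b)// px// subrr oppr0.
Qed.

End Orthogonality.

Section OperatorAdditivity.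
Context {R : realType} {s : scalar_kind} {H K : hilbertSpace R s}.
Implicit Types T : operator H K.

Lemma opD {T x y} : dom T x -> dom T y -> T (x + y) = T x + T y.
Proof. by move=> dx dy; rewrite -[x]scale1r op_linear// !scale1r. Qed.

Lemma domD {T x y} : dom T x -> dom T y -> dom T (x + y).
Proof. by move=> dx dy; rewrite -[x]scale1r; exact: dom_linear. Qed.

End OperatorAdditivity.

Section MoorePenrose.
Context {R : realType} {s : scalar_kind} {H K : hilbertSpace R s}.
Context {T : operator H K} {S : operator K H} (TS : is_mp_inverse T S).

Let range_dom r : op_range T r -> dom S r.
Proof.
case: TS => -[-> _] _ _ rr.
by exists r => //; exists 0; rewrite ?addr0//; exact: perp0.
Qed.

Let perp_dom p : perp (op_range T) p -> dom S p.
Proof.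
case: TS => -[-> _] _ _ pp.
by exists 0; [exact: op_range0|exists p; rewrite ?add0r].
Qed.

Lemma mp_inverseD r p : op_range T r -> perp (op_range T) p ->
  S (r + p) = S r.
Proof.
move=> rr pp; rewrite opD; [|exact: range_dom|exact: perp_dom].
by have [_ _ S0] := TS; rewrite (S0 p)// addr0.
Qed.

(** Both sides lie in the carrier and have the same image under [T], which is injective there. *)
Lemma mp_inverseK {c} : carrier T c -> S (T c) = c.
Proof.
move=> cc; have rTc : op_range T (T c) by exists c => //; exact: cc.1.
case: TS => _ /(_ _ rTc)[cS TSc] _.
exact: carrier_inj cS cc TSc.
Qed.

Lemma range_mp_inverse : op_range S = carrier T.
Proof.
apply/seteqP; split=> [_ [y dy <-]|c cc].
  have [[defS _] Sr _] := TS.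
  move: dy; rewrite defS => -[r rr [p pp ->]].
  by rewrite mp_inverseD//; case: (Sr _ rr).
exists (T c); last exact: mp_inverseK.
by apply: range_dom; exists c => //; exact: cc.1.
Qed.

Lemma null_space_mp_inverse : null_space S = perp (op_range T).
Proof.
have [[defS _] Sr Sp] := TS.
apply/seteqP; split=> [y [dy Sy]|p pp]; last first.
  by split; [exact: perp_dom|exact: Sp].
move: dy Sy; rewrite defS => -[r rr [p pp ->]].
(* Since [r = T (S r)], the vanishing of [S r] forces [r = 0], leaving only [p]. *)
rewrite mp_inverseD// => Sr0; case: (Sr _ rr) => _.
by rewrite Sr0 op0 => <-; rewrite add0r.
Qed.

(** The range of [T] may fail to be closed; intersecting its double orthogonal complement with
    [dom S] still gives back the range alone. *)
Lemma carrier_mp_inverse : carrier S = op_range T.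
Proof.
rewrite /carrier null_space_mp_inverse.
apply/seteqP; split=> [y [dy py]|r rr]; last first.
  by split; [exact: range_dom|move=> p /(_ _ rr)/inner_sym0].
have [[defS _] _ _] := TS.
move: dy py; rewrite defS => -[r rr [p pp ->]] py.
suff -> : p = 0 by rewrite addr0.
(* Both [r + p] and [r] are orthogonal to every [q] in [perp (op_range T)], hence so is [p], which
   itself lies there. *)
apply: (perp_disj pp) => q pq; move: (py _ pq).
by rewrite linearDl /= (inner_sym0 (pq _ rr)) add0r.
Qed.

Lemma decomposable_mp_inverse : decomposable S.
Proof.
rewrite /decomposable null_space_mp_inverse carrier_mp_inverse.
have [[-> _] _ _] := TS; split=> [|p r pp rr]; last exact: pp.
(* Only the order of the two summands changes. *)
by apply/seteqP; split=> _ [x Ax [y By ->]];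
  exists y => //; exists x => //; rewrite addrC.
Qed.

End MoorePenrose.

Section DoubleMoorePenrose.
Context {R : realType} {s : scalar_kind} {H K : hilbertSpace R s}.
Context {T U : operator H K} {S : operator K H}.
Hypotheses (TS : is_mp_inverse T S) (SU : is_mp_inverse S U).

Lemma dom_mp_inverse2 : dom U = set_sum (carrier T) (perp (carrier T)).
Proof. by have [[-> _] _ _] := SU; rewrite (range_mp_inverse TS). Qed.

Lemma mp_inverse2E c x : carrier T c -> perp (carrier T) x -> U (c + x) = T c.
Proof.
move=> cc px; rewrite (mp_inverseD SU) ?(range_mp_inverse TS)//.
(* Write [c] as [S (T c)]; since [T c] is in the carrier of [S], [U] undoes [S] on it. *)
rewrite -{1}(mp_inverseK TS cc) (mp_inverseK SU)// (carrier_mp_inverse TS).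
by exists c => //; exact: cc.1.
Qed.

Lemma op_sub_mp_inverse2 : decomposable T -> op_sub T U.
Proof.
move=> [domT _].
(* The null component [n] is orthogonal to [carrier T], so the same splitting fits the domain of
   [U]. *)
have domTE x : dom T x -> exists c n,
    [/\ x = c + n, carrier T c, null_space T n & perp (carrier T) n].
  rewrite domT => -[n Nn [c cc ->]]; exists c, n; split=> //; first exact: addrC.
  by move=> c' [_ /(_ _ Nn)/inner_sym0].
split=> _ /domTE[c [n [-> cc [dn Tn] pn]]].
  by rewrite dom_mp_inverse2; exists c => //; exists n.
by rewrite mp_inverse2E// opD ?Tn ?addr0//; exact: cc.1.
Qed.

(** On [c + n], with [c] in the carrier and [n] orthogonal to it, [U] and [B] both give [T c]. The
    closure of [T] will serve as [B]. *)
Lemma mp_inverse2_op_sub {B : operator H K} :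
  op_sub T B -> perp (carrier T) `<=` null_space B -> op_sub U B.
Proof.
move=> [TB_dom TB] pB; split=> x; rewrite dom_mp_inverse2.
  move=> [c [dc _] [n /pB[dn _] ->]].
  by apply: domD => //; exact: TB_dom.
move=> [c cc [n pn ->]]; rewrite mp_inverse2E//.
have [dn Bn] := pB _ pn; have [dc _] := cc.
by rewrite opD ?Bn ?addr0 ?TB//; exact: TB_dom.
Qed.

End DoubleMoorePenrose.

Theorem theorem2p3 (R : realType) (s : scalar_kind) (H K : hilbertSpace R s)
    (T : operator H K) (T_dense : dense (dom T)) (T_closable : closable T)
    (T_decomp : decomposable T)
    (T_null : null_space (op_closure T_closable) = closure (null_space T)) :
  exists Tdag_decomp : decomposable (mp_inverse T_decomp),
    op_sub T (mp_inverse Tdag_decomp) /\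
    op_sub (mp_inverse Tdag_decomp) (op_closure T_closable).
Proof.
have TS := mp_inverseP T_decomp.
exists (decomposable_mp_inverse TS).
have SU := mp_inverseP (decomposable_mp_inverse TS).
split; first exact: op_sub_mp_inverse2 TS SU T_decomp.
have [_ TB _] := op_closureP T_closable.
(* The hypothesis on the null space turns the condition on [B] into [perp (carrier T)] lying in the
   closure of [null_space T]. *)
apply: (mp_inverse2_op_sub TS SU TB); rewrite T_null.
have [domT orthT] := T_decomp.
by apply: perp_sub_closure orthT; rewrite -domT.
Qed.
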